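(* Let $K \subsetneq L$ be a field extension, and let $A$ and $B$ be two $n$-dimensional $K$-subspaces of $L$, with $n > 0$ and $1 \notin A$. Assume that for every nonzero $K$-subspace $R$ of $B$, we have $$\dim_K (K(R) \cap A) \geq \dim_K R.$$ Then the pair $(A,B)$ is matchable.
   Context: Let $K\subsetneq L$ be a field extension and let $A,B$ be $n$-dimensional $K$-subspaces of $L$ with $n>0$. For a subset $X$ of $L$, $\langle X\rangle$ denotes the $K$-subspace of $L$ spanned by $X$. An ordered basis $\{a_1,\ldots,a_n\}$ of $A$ is matched to an ordered basis $\{b_1,\ldots,b_n\}$ of $B$ if, for each $i\in\{1,\ldots,n\}$, $a_i^{-1}A\cap B\subseteq \langle b_1,\ldots,b_{i-1},b_{i+1},\ldots,b_n\rangle$. The subspace $A$ is matched to $B$ (equivalently, the pair $(A,B)$ is matchable) if every ordered basis of $A$ can be matched to some ordered basis of $B$. For a subset $R\subseteq L$, $K(R)$ denotes the smallest subfield of $L$ containing $K\cup R$. *)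

(* Defs.v *)
From HB Require Import structures.
From mathcomp Require Import all_boot all_algebra.
From mathcomp Require Import boolp classical_sets.
Set Implicit Arguments.
Unset Strict Implicit.
Unset Printing Implicit Defensive.
Import GRing.Theory.
Local Open Scope ring_scope.
Local Open Scope classical_set_scope.

(* A field extension L of K of arbitrary, possibly infinite, degree: K embeds
   in L as the scalars c%:A, i.e. as range (in_alg L). (fieldExtType would
   impose a finite degree.) *)
#[short(type="fieldAlgType")]
HB.structure Definition FieldAlgebra (K : fieldType) :=
  {L of GRing.ComUnitAlgebra K L & GRing.Field L}.

Section FieldExtension.
Variables (K : fieldType) (L : fieldAlgType K).
Implicit Types (V A B R X F : set L) (n : nat).

Definition is_subspace V : Prop := GRing.submod_closed [in V].

Definition is_subfield F : Prop := GRing.divring_closed [in F].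

Definition Kspan X : set L := smallest is_subspace X.

(* K(R) *)
Definition Kadjoin R : set L := smallest is_subfield (range (in_alg L) `|` R).

Definition lin_indep n (b : 'I_n -> L) : Prop :=
  forall c : 'I_n -> K, \sum_(i < n) c i *: b i = 0 -> forall i, c i = 0.

Definition ordered_basis V n (b : 'I_n -> L) : Prop :=
  lin_indep b /\ Kspan (range b) = V.

(* V has finite dimension n; no n qualifies when V is infinite dimensional or
   is not a subspace. *)
Definition has_dim V n : Prop := exists b : 'I_n -> L, ordered_basis V b.

Definition basis_matched A B n (a b : 'I_n -> L) : Prop :=
  forall i : 'I_n,
    [set (a i)^-1 * x | x in A] `&` B `<=` Kspan [set b j | j in [set j | j != i]].

Definition matchable n A B : Prop :=
  forall a : 'I_n -> L, ordered_basis A a ->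
    exists b : 'I_n -> L, ordered_basis B b /\ basis_matched A B a b.

End FieldExtension.

(* Main.v *)
(* Fix a basis a of A. By Rado's theorem, applied to the annihilators in the
   dual of B of the spaces a_i^-1 A `&` B, a matched basis of B exists as soon as
   #|J| + dim R <= n for every J, where R is the intersection of these spaces over
   i in J. With X the span of the a_i, i in J, one has X R <= A. Dyson's
   e-transforms (X, R) -> (X + eR, R `&` e^-1 X), e in X, keep X, X R <= A and
   dim X + dim R = const, and end with X R <= X. Then X is a K(R)-space, so 1 \notin A
   gives X `&` K(R) = 0, and dim A >= dim X + dim (K(R) `&` A) >= dim X + dim R. *)
Require Import Defs.
From HB Require Import structures.
From mathcomp Require Import all_boot all_algebra.
From mathcomp Require Import boolp classical_sets.
From mathcomp Require Import zify.
Set Implicit Arguments.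
Unset Strict Implicit.
Unset Printing Implicit Defensive.
Import GRing.Theory.
Local Open Scope ring_scope.
Local Open Scope classical_set_scope.

(** * Rado's theorem on independent transversals, for a family of [n] subspaces of [K^n] *)

Section Rado.
Variables (K : fieldType) (n : nat).

(** One summand is the line through a nonzero row of [D], the other a complement of that line in
    [D]. *)
Lemma mxrank_gt1_split (D : 'M[K]_n) : (1 < \rank D)%N ->
  exists U V : 'M[K]_n, [/\ (U + V == D)%MS, (\rank U < \rank D)%N
    & (\rank V < \rank D)%N].
Proof.
move=> rD; set u := nz_row D.
have uD : (u <= D)%MS by rewrite nz_row_sub.
have ru : \rank u = 1%N.
  by rewrite rank_rV nz_row_eq0 -mxrank_eq0; case: (\rank D) rD.
exists <<u>>%MS, (D :\: <<u>>)%MS; split.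
- apply/eqmxP; apply: eqmx_trans (addsmx_diff_cap_eq D <<u>>%MS).
  rewrite addsmxC; apply: adds_eqmx => //; apply: eqmx_sym; apply/eqmxP.
  by rewrite capmxSr sub_capmx submx_refl genmxE uD.
- by rewrite genmxE ru.
have := mxrank_cap_compl D <<u>>%MS.
have -> : \rank (D :&: <<u>>)%MS = 1%N.
  apply: etrans ru; rewrite -(genmxE u); apply: eqmx_rank.
  by rewrite capmxSr sub_capmx submx_refl genmxE uD.
lia.
Qed.

(** Rado's rank form of Hall's condition; each subspace is the row space of a square matrix. *)
Definition hall (D : 'I_n -> 'M[K]_n) :=
  forall J : {set 'I_n}, (#|J| <= \rank (\sum_(j in J) D j)%MS)%N.

(** A set violating the condition after the change must contain [i]. Removing [i] from it gives [J]
    and turns the strict inequality into a weak one. *)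
Lemma hallF (D : 'I_n -> 'M[K]_n) i (U : 'M[K]_n) :
  hall D -> ~ hall (fun j => if j == i then U else D j) ->
  exists2 J : {set 'I_n}, i \notin J & (\rank (U + \sum_(j in J) D j)%MS <= #|J|)%N.
Proof.
pose D' j := if j == i then U else D j.
rewrite -/(hall D') => hD /existsNP[J].
have eqD (I : {set 'I_n}) : i \notin I ->
    (\sum_(j in I) D' j = \sum_(j in I) D j)%MS.
  move=> iI; apply: eq_bigr => j jI; rewrite /D'; case: eqP => // ji.
  by rewrite -ji jI in iI.
have [iJ|iJ] := boolP (i \in J); last by rewrite eqD //; have := hD J.
move=> /negP; rewrite -ltnNge -(finset.setD1K iJ) big_setU1 ?finset.setD11 //.
rewrite eqD ?finset.setD11 // eqxx cardsU1 finset.setD11 /= add1n ltnS => h.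
by exists (J :\ i); rewrite ?finset.setD11.
Qed.

(* A subspace of dimension at least 2 is a sum of two proper subspaces; by
   submodularity of the rank, shrinking it to one of them keeps Hall's condition. *)
Lemma rado_subspaces (D : 'I_n -> 'M[K]_n) : hall D ->
  exists2 F : 'M[K]_n, F \in unitmx & forall i, (row i F <= D i)%MS.
Proof.
have [m] := ubnP (\sum_(i < n) \rank (D i)).
elim: m D => // m IH D; rewrite ltnS => Dm hD.
have [[i ri]|] := pselect (exists i, 1 < \rank (D i))%N.
  have [U [V [/eqmxP UV rU rV]]] := mxrank_gt1_split ri.
  have shrink (W : 'M[K]_n) : (W <= D i)%MS -> (\rank W < \rank (D i))%N ->
      hall (fun j => if j == i then W else D j) ->
      exists2 F : 'M[K]_n, F \in unitmx & forall i, (row i F <= D i)%MS.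
    move=> WD rW hW; case: (IH _ _ hW) => [|F Fu FW].
      apply: leq_trans Dm; rewrite (bigD1 i) //= eqxx [X in (_ < X)%N](bigD1 i) //=.
      rewrite -addSn leq_add //; apply: leq_sum => j /negPf -> //.
    exists F => // j; apply: submx_trans (FW j) _.
    by case: eqP => // ->.
  have UD : (U <= D i)%MS by rewrite -UV addsmxSl.
  have VD : (V <= D i)%MS by rewrite -UV addsmxSr.
  case: (pselect (hall (fun j => if j == i then U else D j))) => [/shrink|/(hallF hD)].
    exact.
  move=> [J1 iJ1 h1].
  case: (pselect (hall (fun j => if j == i then V else D j))) => [/shrink|/(hallF hD)].
    exact.
  move=> [J2 iJ2 h2]; exfalso.
  (* By [h1] and [h2] the two ranks add up to at most [#|J1| + #|J2|]. Since [U + V] is [D i],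
     Hall's condition bounds the ranks of the sum and the intersection below by the sizes of
     [i |: (J1 :|: J2)] and [J1 :&: J2], whose total is one larger. *)
  have := mxrank_sum_cap (U + \sum_(j in J1) D j)%MS (V + \sum_(j in J2) D j)%MS.
  have cap : (#|J1 :&: J2| <= \rank ((U + \sum_(j in J1) D j) :&:
      (V + \sum_(j in J2) D j))%MS)%N.
    apply: leq_trans (hD _) (mxrankS _); apply/sumsmx_subP => j.
    rewrite inE => /andP[j1 j2]; rewrite sub_capmx.
    rewrite (submx_trans _ (addsmxSr _ _)) ?(sumsmx_sup j) //.
    by rewrite (submx_trans _ (addsmxSr _ _)) ?(sumsmx_sup j).
  have cup : (#|i |: (J1 :|: J2)| <=
      \rank ((U + \sum_(j in J1) D j) + (V + \sum_(j in J2) D j))%MS)%N.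
    apply: leq_trans (hD _) (mxrankS _); apply/sumsmx_subP => j.
    rewrite !inE => /orP[/eqP->|/orP[]jJ].
    - by rewrite -UV addsmxS ?addsmxSl.
    - rewrite (submx_trans _ (addsmxSl _ _)) // (submx_trans _ (addsmxSr _ _)) //.
      exact: sumsmx_sup jJ _.
    - rewrite (submx_trans _ (addsmxSr _ _)) // (submx_trans _ (addsmxSr _ _)) //.
      exact: sumsmx_sup jJ _.
  have : #|i |: (J1 :|: J2)| = #|J1 :|: J2|.+1.
    by rewrite cardsU1 inE negb_or iJ1 iJ2.
  have := cardsUI J1 J2; lia.
(* All ranks are now at most 1, and exactly 1 by Hall's condition on singletons. Generators of these
   lines span [K^n] by Hall's condition on the full index set. *)
move=> r1.
have {}r1 i : exists v : 'rV[K]_n, (v == D i)%MS.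
  have r : (\rank (D i) <= 1)%N by rewrite leqNgt; apply/negP => ?; apply: r1; exists i.
  exists (nz_row (D i)).
  have sub := nz_row_sub (D i).
  rewrite -(geq_leqif (mxrank_leqif_eq sub)) (leq_trans r) //.
  rewrite lt0n mxrank_eq0 nz_row_eq0 -mxrank_eq0 -lt0n.
  by have := hD [set i]%SET; rewrite cards1 big_set1.
have [v vD] := choice r1.
exists (\matrix_i v i) => [|i]; last by rewrite rowK (eqmxP (vD i)).
rewrite -row_full_unit /row_full eqn_leq rank_leq_row /=.
have := hD [set: 'I_n]%SET; rewrite cardsT card_ord => /leq_trans -> //.
apply/mxrankS/sumsmx_subP => i _.
by rewrite -(eqmxP (vD i)) -[v i](rowK v) row_sub.
Qed.

End Rado.

(** * Subspaces of [L]: coordinates and dimension *)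

Section Subspaces.
Variables (K : fieldType) (L : fieldAlgType K).
Implicit Types (V W X Y R : set L).

Lemma is_subspaceP V :
  is_subspace V <-> V 0 /\ forall (c : K) x y, V x -> V y -> V (c *: x + y).
Proof.
split=> -[V0 VL]; (split; first by move: V0; rewrite inE).
  by move=> c x y Vx Vy; have := VL c x y; rewrite !inE; apply.
by move=> c x y; rewrite !inE; apply: VL.
Qed.

Lemma subspace0 V : is_subspace V -> V 0.
Proof. by move=> /is_subspaceP[]. Qed.

Lemma subspaceL V (c : K) x y : is_subspace V -> V x -> V y -> V (c *: x + y).
Proof. by move=> /is_subspaceP[_]; apply. Qed.

Lemma subspaceZ V (c : K) x : is_subspace V -> V x -> V (c *: x).
Proof. by move=> sV Vx; rewrite -[_ *: x]addr0; apply: subspaceL (subspace0 sV). Qed.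

Lemma subspaceD V x y : is_subspace V -> V x -> V y -> V (x + y).
Proof. by move=> sV Vx Vy; rewrite -[x]scale1r; apply: subspaceL. Qed.

Lemma subspace_sum V (I : finType) (P : pred I) (F : I -> L) : is_subspace V ->
  (forall i, P i -> V (F i)) -> V (\sum_(i | P i) F i).
Proof.
by move=> sV FV; elim/big_ind: _ => // [|x y]; [apply: subspace0|apply: subspaceD].
Qed.

Lemma subspaceI V W : is_subspace V -> is_subspace W -> is_subspace (V `&` W).
Proof.
move=> sV sW; apply/is_subspaceP; split; first by split; apply: subspace0.
by move=> c x y [Vx Wx] [Vy Wy]; split; apply: subspaceL.
Qed.

Definition sumset V W : set L := [set x + y | x in V & y in W].

Lemma sumset_sub V W X : is_subspace X -> V `<=` X -> W `<=` X -> sumset V W `<=` X.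
Proof.
by move=> sX VX WX _ [x Vx [y Wy <-]]; apply: subspaceD; [|apply: VX|apply: WX].
Qed.

Lemma subspace_scale V (e : L) : is_subspace V -> is_subspace [set e * x | x in V].
Proof.
move=> sV; apply/is_subspaceP; split.
  by exists 0; [exact: subspace0|rewrite mulr0].
move=> c _ _ [x Vx <-] [y Vy <-]; exists (c *: x + y); first exact: subspaceL.
by rewrite mulrDr scalerAr.
Qed.

(** A linear map from coordinate rows to [L], through which matrix rank computes dimensions even
    when [L] has infinite degree. *)
Definition comb q (w : 'I_q -> L) (u : 'rV[K]_q) : L := \sum_i u 0 i *: w i.

Lemma comb_is_linear q (w : 'I_q -> L) : linear (comb w).
Proof.
move=> c u v; rewrite /comb scaler_sumr -big_split; apply: eq_bigr => i _.
by rewrite !mxE scalerDl scalerA.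
Qed.

HB.instance Definition _ q (w : 'I_q -> L) :=
  GRing.isLinear.Build K 'rV[K]_q L _ (comb w) (comb_is_linear w).

Definition comb_rows q r (w : 'I_q -> L) (M : 'M[K]_(r, q)) : set L :=
  [set comb w u | u in [set u | (u <= M)%MS]].

Lemma comb_delta q (w : 'I_q -> L) i : comb w (delta_mx 0 i) = w i.
Proof.
rewrite /comb (bigD1 i) //= big1 => [|j ji]; first by rewrite mxE !eqxx scale1r addr0.
by rewrite mxE (negPf ji) andbF scale0r.
Qed.

Lemma comb_mulmx q r (w : 'I_q -> L) (M : 'M[K]_(r, q)) u :
  comb w (u *m M) = comb (fun i => comb w (row i M)) u.
Proof.
rewrite mulmx_sum_row linear_sum; apply: eq_bigr => i _; exact: linearZ.
Qed.

Lemma lin_indepP q (w : 'I_q -> L) : lin_indep w <-> injective (comb w).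
Proof.
split=> [wi u v uv|winj c c0 i].
  apply/rowP => i; apply/eqP; rewrite -subr_eq0; apply/eqP.
  have := wi (fun i => (u - v) 0 i) _ i; rewrite !mxE; apply.
  by apply/eqP; rewrite -/(comb w (u - v)) linearB subr_eq0 /= uv.
have /rowP/(_ i) : \row_i c i = 0.
  by apply: winj; rewrite linear0 -c0; apply: eq_bigr => j _; rewrite mxE.
by rewrite !mxE.
Qed.

Lemma Kspan_sub V X : is_subspace V -> X `<=` V -> Kspan X `<=` V.
Proof. by move=> sV XV x; apply. Qed.

Lemma sub_Kspan X : X `<=` Kspan X.
Proof. by move=> x Xx V [_]; apply. Qed.

Lemma subspace_Kspan X : is_subspace (Kspan X).
Proof.
apply/is_subspaceP; split=> [V [sV _]|c x y Xx Xy V XV]; first exact: subspace0.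
by have [sV _] := XV; apply: subspaceL => //; [apply: Xx|apply: Xy].
Qed.

Lemma subspace_range_comb q (w : 'I_q -> L) : is_subspace (range (comb w)).
Proof.
apply/is_subspaceP; split; first by exists 0; rewrite ?linear0.
by move=> c _ _ [u _ <-] [v _ <-]; exists (c *: u + v); rewrite // linearP.
Qed.

Lemma Kspan_range q (w : 'I_q -> L) : Kspan (range w) = range (comb w).
Proof.
rewrite eqEsubset; split.
  apply: Kspan_sub (subspace_range_comb _) _ => _ [i _ <-].
  by exists (delta_mx 0 i); rewrite // comb_delta.
move=> _ [u _ <-]; apply: subspace_sum (subspace_Kspan _) _ => i _.
by apply: subspaceZ (subspace_Kspan _) _; apply: sub_Kspan; exists i.
Qed.

Lemma comb_inj_neq0 n (a : 'I_n -> L) i : injective (comb a) -> a i != 0.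
Proof.
move=> ainj; apply/eqP; rewrite -comb_delta -(linear0 (comb a)) => /ainj.
by move=> /matrixP/(_ 0 i); rewrite !mxE !eqxx => /eqP; rewrite oner_eq0.
Qed.

Lemma ordered_basisP V q (w : 'I_q -> L) :
  ordered_basis V w <-> injective (comb w) /\ range (comb w) = V.
Proof. by rewrite /ordered_basis lin_indepP Kspan_range. Qed.

Lemma has_dim_subspace V q : has_dim V q -> is_subspace V.
Proof. by move=> [w [_ <-]]; apply: subspace_Kspan. Qed.

Lemma has_dim_comb q r (w : 'I_q -> L) (M : 'M[K]_(r, q)) : injective (comb w) ->
  has_dim (comb_rows w M) (\rank M).
Proof.
move=> winj; exists (fun i => comb w (row i (row_base M))); apply/ordered_basisP.
split=> [u v|].
  by rewrite -!comb_mulmx => /winj; apply: row_free_inj; apply: row_base_free.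
rewrite eqEsubset; split=> [_ [u _ <-]|_ [u uM <-]].
  exists (u *m row_base M); last exact: comb_mulmx.
  by rewrite /= (submx_trans (submxMl _ _)) ?eq_row_base.
move: uM; rewrite /= -(eq_row_base M) => /submxP[v ->].
by exists v; rewrite // comb_mulmx.
Qed.

(** Among the matrices whose row space is mapped into [V], one of maximal rank reaches all of [V]:
    the coordinates of a missed vector, added to it, would raise the rank. *)
Lemma subspace_coord V W q (w : 'I_q -> L) : ordered_basis W w ->
  is_subspace V -> V `<=` W ->
  exists M : 'M[K]_q, V = comb_rows w M.
Proof.
move=> /ordered_basisP[winj wW] sV VW.
pose P k := `[< exists M : 'M[K]_q,
  \rank M = k /\ forall u, (u <= M)%MS -> V (comb w u) >].
have exP : exists k, P k.
  exists 0%N; apply/asboolP; exists 0; split; first exact: mxrank0.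
  by move=> u; rewrite submx0 => /eqP->; rewrite linear0; apply: subspace0.
have ubP k : P k -> (k <= q)%N by move=> /asboolP[M [<- _]]; apply: rank_leq_row.
case: (ex_maxnP exP ubP) => k /asboolP[M [rM MV]] maxk.
exists M; rewrite eqEsubset; split=> [x Vx|_ [u uM <-]]; last exact: MV.
have /= [u _ ux] : range (comb w) x by rewrite wW; apply: VW.
exists u => //=.
have /maxk : P (\rank (M + u)%MS).
  apply/asboolP; exists (M + u)%MS; split=> // v /sub_addsmxP[[y z] ->] /=.
  rewrite linearD; apply: subspaceD => //; first by apply: MV; rewrite submxMl.
  by rewrite [z]mx11_scalar mul_scalar_mx linearZ /= ux; apply: subspaceZ.
rewrite -rM => rMu; have := mxrank_leqif_sup (addsmxSl M u).
by move=> /geq_leqif; rewrite rMu addsmx_sub submx_refl /= => <-.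
Qed.

(** The coordinates of a basis of [V] in a basis of [W] form a [p] by [q] matrix with independent
    rows. *)
Lemma has_dim_le V W p q :
  has_dim V p -> has_dim W q -> V `<=` W -> (p <= q)%N.
Proof.
move=> [v /ordered_basisP[vinj vV]] [w /ordered_basisP[winj wW]] VW.
have /choice[c cE] i : exists u, comb w u = v i.
  have /= [u _ <-] : range (comb w) (v i); last by exists u.
  by rewrite wW; apply: VW; rewrite -vV; exists (delta_mx 0 i) => //; apply: comb_delta.
pose C := \matrix_i c i.
have cC u : comb w (u *m C) = comb v u.
  by rewrite comb_mulmx; apply: eq_bigr => i _; rewrite rowK cE.
have : row_free C.
  rewrite -kermx_eq0 -submx0; apply/row_subP => i; rewrite submx0; apply/eqP.
  apply: vinj; rewrite -cC linear0 -row_mul mulmx_ker row0 linear0 //.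
by rewrite /row_free => /eqP <-; apply: rank_leq_col.
Qed.

Lemma has_dim_uniq V p q : has_dim V p -> has_dim V q -> p = q.
Proof.
by move=> Vp Vq; apply/eqP; rewrite eqn_leq !(has_dim_le Vp Vq, has_dim_le Vq Vp).
Qed.

Lemma has_dim_eq V W p : has_dim V p -> has_dim W p -> V `<=` W -> V = W.
Proof.
move=> Vp Wp VW; have [w ww] := Wp; have /ordered_basisP[winj wW] := ww.
have [M VM] := subspace_coord ww (has_dim_subspace Vp) VW.
rewrite eqEsubset; split=> // x; rewrite -wW => -[u _ <-]; rewrite VM.
exists u => //=; apply: submx_full.
rewrite /row_full; apply/eqP; apply: has_dim_uniq Vp; rewrite VM.
exact: has_dim_comb.
Qed.

(** The space [U] provides common coordinates, in which this is the rank formula for the sum and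
    intersection of row spaces. *)
Lemma has_dim_sumset_cap U V W m p q : has_dim U m -> V `<=` U -> W `<=` U ->
  has_dim V p -> has_dim W q ->
  exists s t, [/\ has_dim (sumset V W) s, has_dim (V `&` W) t & (s + t = p + q)%N].
Proof.
move=> [w ww] VU WU Vp Wq; have /ordered_basisP[winj _] := ww.
have [M VM] := subspace_coord ww (has_dim_subspace Vp) VU.
have [N WN] := subspace_coord ww (has_dim_subspace Wq) WU.
exists (\rank (M + N)%MS), (\rank (M :&: N)%MS); split.
- suff -> : sumset V W = comb_rows w (M + N)%MS.
    exact: has_dim_comb.
  rewrite VM WN eqEsubset; split.
    move=> _ [_ [u uM <-] [_ [v vN <-] <-]]; exists (u + v); last exact: linearD.
    exact: addmx_sub_adds.
  move=> _ [_ /sub_addsmxP[[u v] -> /=] <-].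
  exists (comb w (u *m M)); first by exists (u *m M) => //=; apply: submxMl.
  exists (comb w (v *m N)); first by exists (v *m N) => //=; apply: submxMl.
  by rewrite linearD.
- suff -> : V `&` W = comb_rows w (M :&: N)%MS.
    exact: has_dim_comb.
  rewrite VM WN eqEsubset; split.
    move=> _ [[u uM <-] [v vN /winj uv]]; exists u => //=.
    by rewrite sub_capmx uM -uv.
  by move=> _ [u /= + <-]; rewrite sub_capmx => /andP[uM uN]; split; exists u.
rewrite mxrank_sum_cap; congr addn; apply: has_dim_uniq (has_dim_comb _ winj) _.
  by rewrite -VM.
by rewrite -WN.
Qed.

Lemma has_dim_scale V p (e : L) : e != 0 -> has_dim V p ->
  has_dim [set e * x | x in V] p.
Proof.
move=> e0 [v /ordered_basisP[vinj vV]]; exists (fun i => e * v i).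
have ev u : comb (fun i => e * v i) u = e * comb v u.
  by rewrite /comb mulr_sumr; apply: eq_bigr => i _; rewrite scalerAr.
apply/ordered_basisP; split=> [u u'|].
  by rewrite !ev => /(mulfI e0); apply: vinj.
rewrite -vV eqEsubset; split=> [_ [u _ <-]|_ [_ [u _ <-] <-]].
  by exists (comb v u); [exists u|rewrite ev].
by exists u.
Qed.

End Subspaces.

(** * Stabilizers, the e-transform argument and dual bases *)

Section Matching.
Variables (K : fieldType) (L : fieldAlgType K).
Implicit Types (A B V X R : set L).

Definition stabilizer V : set L := [set h | forall x, V x -> V (h * x)].

(** Finite dimension gives inverses: for nonzero [h], the inclusion of [h V] in [V] is an equality.
    The inverse of 0 is 0 by convention. *)
Lemma subfield_stabilizer V q : has_dim V q -> is_subfield (stabilizer V).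
Proof.
move=> Vq; have sV := has_dim_subspace Vq.
have stabM h k : stabilizer V h -> stabilizer V k -> stabilizer V (h * k).
  by move=> hV kV x Vx; rewrite -mulrA; apply/hV/kV.
have stabV h : stabilizer V h -> stabilizer V h^-1.
  move=> hV x Vx; have [->|h0] := eqVneq h 0.
    by rewrite invr0 mul0r; apply: subspace0.
  have hVV : [set h * x | x in V] = V.
    by apply: has_dim_eq (has_dim_scale h0 Vq) Vq _ => _ [y Vy <-]; apply: hV.
  by move: Vx; rewrite -{1}hVV => -[y Vy <-]; rewrite mulKf.
split=> [|h k|h k]; rewrite !inE; first by move=> x; rewrite mul1r.
  move=> hV kV x Vx; rewrite mulrBl addrC -scaleN1r.
  by apply: subspaceL => //; [apply: kV|apply: hV].
by move=> hV /stabV; apply: stabM.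
Qed.

Lemma subfield_Kadjoin R : is_subfield (Kadjoin R).
Proof.
split=> [|h k|h k]; rewrite !inE.
- by move=> F [[F1 _ _] _]; rewrite -in_setE.
- move=> hR kR F [sF RF]; have [_ FB _] := sF.
  by have := FB h k; rewrite !inE; apply; [apply: hR|apply: kR].
- move=> hR kR F [sF RF]; have [_ _ FV] := sF.
  by have := FV h k; rewrite !inE; apply; [apply: hR|apply: kR].
Qed.

Lemma subfieldV (F : set L) x : is_subfield F -> F x -> F x^-1.
Proof.
move=> [F1 _ FV] Fx; rewrite -div1r; have := FV 1 x; rewrite !inE; apply => //.
by rewrite -in_setE.
Qed.

(** The stabilizer is a subfield containing the scalars and [R], hence contains the smallest one. *)
Lemma Kadjoin_stable V R q : has_dim V q ->
  (forall x r, V x -> R r -> V (x * r)) -> Kadjoin R `<=` stabilizer V.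
Proof.
move=> Vq VR h; apply; split; first exact: subfield_stabilizer Vq.
have sV := has_dim_subspace Vq.
move=> r [[c _ <-]|Rr] x Vx; first by rewrite mulr_algl; apply: subspaceZ.
by rewrite mulrC; apply: VR.
Qed.

(** This bound yields Hall's condition. The induction is on [r]: unless [X R] lies in [X], a
    suitable e-transform shrinks [R] strictly and keeps [p + r]. *)
Lemma product_dim_le A B n : ~ A 1 -> has_dim A n ->
  (forall R r, is_subspace R -> R `<=` B -> R <> [set 0] -> has_dim R r ->
    exists2 d, has_dim (Kadjoin R `&` A) d & (r <= d)%N) ->
  forall X R p r, has_dim X p -> has_dim R r -> X `<=` A -> R `<=` B ->
    (forall x y, X x -> R y -> A (x * y)) -> (p + r <= n)%N.
Proof.
move=> A1 An dimK X R p r.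
have [m] := ubnP r; elim: m X R p r => // m IH X R p r; rewrite ltnS => rm.
move=> Xp Rr XA RB XRA; have sX := has_dim_subspace Xp; have sR := has_dim_subspace Rr.
have sA := has_dim_subspace An.
have [XR|] := pselect (forall x y, X x -> R y -> X (x * y)).
  (* The hypothesis on [K(R)] concerns nonzero [R] only; for [r = 0] the inclusion of [X] in [A]
     suffices. *)
  case: r Rr {rm} => [|r] Rr; first by rewrite addn0; apply: has_dim_le XA.
  have R0 : R <> [set 0].
    move=> R0; have [w /ordered_basisP[winj wR]] := Rr.
    have : range (comb w) (w ord0) by exists (delta_mx 0 ord0); rewrite ?comb_delta.
    by rewrite wR R0 => /eqP; apply/negP; apply: comb_inj_neq0.
  have [d Fd rd] := dimK R _ sR RB R0 Rr.
  have FA : Kadjoin R `&` A `<=` A by move=> x [].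
  have [s [t [Ss Tt st]]] := has_dim_sumset_cap An XA FA Xp Fd.
  (* A nonzero element of this intersection has its inverse in K(R), which
     would put 1 in X. *)
  have t0 : t = 0%N.
    have [w /ordered_basisP[winj wT]] := Tt.
    case: t w {Tt st} winj wT => // t w winj wT.
    have [Xz [Fz _]] : (X `&` (Kadjoin R `&` A)) (w ord0).
      by rewrite -wT; exists (delta_mx 0 ord0); rewrite ?comb_delta.
    case: A1; rewrite -(mulVf (comb_inj_neq0 ord0 winj)); apply: XA.
    exact: (Kadjoin_stable Xp XR (subfieldV (subfield_Kadjoin R) Fz)).
  have := has_dim_le Ss An (sumset_sub sA XA FA); lia.
(* The witness [y] lies in [R] but will not lie in [R'], which makes the descent strict. *)
move=> /existsNP[e /existsNP[y /not_implyP[Xe /not_implyP[Ry Xey]]]].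
have e0 : e != 0.
  by apply/eqP => e0; apply: Xey; rewrite e0 mul0r; apply: subspace0.
have eRA : [set e * x | x in R] `<=` A by move=> _ [x Rx <-]; apply: XRA.
have [s [t [Ss Tt st]]] := has_dim_sumset_cap An XA eRA Xp (has_dim_scale e0 Rr).
pose R' := R `&` [set x | X (e * x)].
(* Multiplication by [e] carries [R'] onto the intersection of [X] and [e R]. *)
have R't : has_dim R' t.
  suff -> : R' = [set e^-1 * x | x in X `&` [set e * x | x in R]].
    by apply: has_dim_scale Tt; rewrite invr_eq0.
  rewrite eqEsubset; split=> [x [Rx Xx]|_ [z [Xz [x Rx xz]] <-]].
    by exists (e * x); [split=> //; exists x|rewrite mulKf].
  by rewrite -xz mulKf //; split; rewrite //= xz.
have R'R : R' `<=` R by move=> x [].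
have tr : (t < r)%N.
  rewrite ltn_neqAle (has_dim_le R't Rr R'R) andbT; apply/eqP => tr.
  rewrite tr in R't; have R'E := has_dim_eq R't Rr R'R.
  by move: Ry; rewrite -R'E => -[].
(* Dyson's e-transform: replace (X, R) by (X + eR, R `&` e^-1 X). *)
rewrite -st; apply: IH Ss R't (sumset_sub sA XA eRA) (subset_trans R'R RB) _.
  exact: leq_trans tr rm.
(* Here [(x + e u) z = x z + (e z) u], where [e z] is in [X] because [z] is in [R']. *)
move=> _ z [x Xx [_ [u Ru <-] <-]] [Rz Xz].
by rewrite mulrDl mulrAC; apply: subspaceD => //; apply: XRA.
Qed.

(** The rows of [F] are read as linear forms on [b0]-coordinates. The rows of the inverse of [F^T]
    form the dual basis, so a vector killed by form [i] has no [b i] component. *)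
Lemma dual_basis B n (b0 : 'I_n -> L) (F : 'M[K]_n) :
  ordered_basis B b0 -> F \in unitmx ->
  let b i := comb b0 (row i (invmx F^T)) in
  ordered_basis B b /\
  forall i u, u *m (row i F)^T = 0 ->
    Kspan [set b j | j in [set j | j != i]] (comb b0 u).
Proof.
move=> /ordered_basisP[b0inj b0B] Fu b.
have Ftu : F^T \in unitmx by rewrite unitmx_tr.
have bE u : comb b u = comb b0 (u *m invmx F^T) by rewrite comb_mulmx.
split=> [|i u ui].
  apply/ordered_basisP; split=> [u v|].
    by rewrite !bE => /b0inj /(can_inj (mulmxK _)); apply; rewrite unitmx_inv.
  rewrite -b0B eqEsubset; split=> [_ [u _ <-]|_ [u _ <-]].
    by exists (u *m invmx F^T).
  by exists (u *m F^T); rewrite // bE mulmxK.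
rewrite -[u](mulmxK Ftu) -bE /comb (bigD1 i) //=.
have -> : (u *m F^T) 0 i = 0.
  move/matrixP/(_ 0 0): ui; rewrite !mxE; apply: etrans.
  by apply: eq_bigr => j _; rewrite !mxE.
rewrite scale0r add0r; apply: subspace_sum (subspace_Kspan _) _ => j ji.
by apply: subspaceZ (subspace_Kspan _) _; apply: sub_Kspan; exists j.
Qed.

(** This matrix selects the basis vectors indexed by [J], so their span has dimension [#|J|]. *)
Lemma rank_rowsub_enum n (J : {set 'I_n}) :
  \rank (rowsub enum_val 1%:M : 'M[K]_(#|J|, n)) = #|J|.
Proof.
apply/eqP/row_freeP; exists (colsub enum_val 1%:M).
rewrite mul_rowsub_mx mul1mx; apply/matrixP => i j; rewrite !mxE.
by rewrite (inj_eq enum_val_inj).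
Qed.

End Matching.

(** * Hall's condition for the annihilators, and the matched basis *)

Theorem corollary3p7 (K : fieldType) (L : fieldAlgType K)
    (KL : range (in_alg L) `<` [set: L])
    (n : nat) (n_gt0 : (0 < n)%N) (A B : set L)
    (subA : is_subspace A) (dimA : has_dim A n)
    (subB : is_subspace B) (dimB : has_dim B n)
    (A1 : ~ A 1)
    (dim_adjoin : forall (R : set L) (r : nat),
       is_subspace R -> R `<=` B -> R <> [set 0] -> has_dim R r ->
       exists2 d : nat, has_dim (Kadjoin R `&` A) d & (r <= d)%N) :
  matchable n A B.
Proof.
move=> a aA; have /ordered_basisP[ainj arange] := aA.
have [b0 b0B] := dimB; have /ordered_basisP[b0inj b0range] := b0B.
pose C i := [set (a i)^-1 * x | x in A] `&` B.
have /choice[M MC] i : exists M : 'M[K]_n,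
    C i = comb_rows b0 M.
  apply: subspace_coord b0B (subspaceI (subspace_scale _ subA) subB) _.
  by move=> x [].
(* The rows of [D i] span the annihilator of [C i]: a row [u] lies in [M i] exactly when
   [u *m cokermx (M i) = 0]. *)
pose D i := (cokermx (M i))^T.
have hD : hall D.
  move=> J; set N := (\sum_(j in J) D j)%MS.
  have := has_dim_comb (rowsub enum_val 1%:M : 'M[K]_(#|J|, n)) ainj.
  rewrite rank_rowsub_enum => XJ.
  (* The vectors killed by every form in [N] lie in each [C j] with [j] in [J]; they form a space of
     dimension [n - \rank N]. *)
  have := has_dim_comb (kermx N^T) b0inj; rewrite mxrank_ker mxrank_tr => RJ.
  have := product_dim_le A1 dimA dim_adjoin XJ RJ.
  (* This keeps the truncated subtraction [n - \rank N] exact. *)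
  have := rank_leq_row N.
  suff XRA x y : comb_rows a (rowsub enum_val 1%:M : 'M[K]_(#|J|, n)) x ->
      comb_rows b0 (kermx N^T)%MS y -> A (x * y).
    move=> rN /(_ _ _ XRA) h; have {h} : (#|J| + (n - \rank N) <= n)%N; last lia.
    apply: h => _ [u _ <-]; first by rewrite -arange; exists u.
    by rewrite -b0range; exists u.
  (* By linearity [x] may be taken to be some [a j] with [j] in [J]; then [y] in [C j] has the form
     [(a j)^-1 * z] with [z] in [A]. *)
  move=> [_ /submxP[v ->] <-] [u /= /sub_kermxP uN <-].
  rewrite comb_mulmx /comb mulr_suml; apply: (subspace_sum subA) => k _.
  rewrite -scalerAl; apply: (subspaceZ _ subA).
  rewrite row_rowsub row1 -/(comb a _) comb_delta -/(comb b0 u).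
  have jJ := enum_valP k; set j := enum_val k in jJ *.
  have uM : (u <= M j)%MS.
    rewrite submxE; have /submxP[Y DY] : (D j <= N)%MS by apply: sumsmx_sup jJ _.
    by rewrite -[cokermx _]trmxK -/(D j) DY trmx_mul mulmxA uN mul0mx.
  have : C j (comb b0 u) by rewrite MC; exists u.
  by move=> [[z Az <-] _]; rewrite mulVKf // comb_inj_neq0.
have [F Fu FD] := rado_subspaces hD.
have [bB bF] := dual_basis b0B Fu.
exists (fun i => comb b0 (row i (invmx F^T))); split=> // i x.
rewrite -/(C i) MC => -[u /= uM <-]; apply: bF.
(* Row [i] of [F] is in the annihilator of [C i], so it kills the coordinates [u]. *)
have /submxP[y ->] := FD i.
by rewrite trmx_mul trmxK mulmxA (eqP (_ : u *m cokermx (M i) == 0)) ?mul0mx // -submxE.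
Qed.
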